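(* Fix $k\ge2$. For each $r=1,2,\dots,k$, the generating function $\sum_{n\ge0}c_{n,r}x^n$, where $c_{n,r}$ is the number of $\pi\in\mathfrak M_n$ containing the pattern $12\ldots k$ exactly $r$ times, equals $$\frac{\left(U_{k-2}\left(\frac{1-x}{2x}\right)-xU_{k-3}\left(\frac{1-x}{2x}\right)\right)^{r-1}}{U_{k-1}^{\,r+1}\left(\frac{1-x}{2x}\right)}.$$
   Context: A permutation $\pi=\pi_1\cdots\pi_n$ is a Motzkin permutation if it avoids the pattern $132$ (no $i<j<k$ with $\pi_i<\pi_k<\pi_j$) and there are no indices $a<b$ with $\pi_a<\pi_b<\pi_{b+1}$; $\mathfrak M_n$ is the set of them. An occurrence of $12\ldots k$ in $\pi$ is a set of indices $i_1<\dots<i_k$ with $\pi_{i_1}<\dots<\pi_{i_k}$. $U_r$ is the Chebyshev polynomial of the second kind: $U_0(t)=1$, $U_1(t)=2t$, $U_r(t)=2tU_{r-1}(t)-U_{r-2}(t)$ for all integers $r$ (so $U_{-1}=0$, $U_{-2}=-1$). The rational functions of $x$ are expanded as formal power series in $x$. *)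

(* Defs.v *)
From HB Require Import structures.
From mathcomp Require Import all_boot all_order all_fingroup all_algebra.

Set Implicit Arguments.
Unset Strict Implicit.
Unset Printing Implicit Defensive.

Import Order.TTheory GRing.Theory Num.Theory.

Local Open Scope nat_scope.

Definition avoids132 n (p : 'S_n) : bool :=
  ~~ [exists i : 'I_n, exists j : 'I_n, exists k : 'I_n,
        [&& i < j, j < k, p i < p k & p k < p j]].

(* c is the index b + 1, when there is one. *)
Definition avoids1_23 n (p : 'S_n) : bool :=
  ~~ [exists a : 'I_n, exists b : 'I_n, exists c : 'I_n,
        [&& a < b, c == b.+1 :> nat, p a < p b & p b < p c]].

Definition motzkin n : {set 'S_n} :=
  [set p : 'S_n | avoids132 p && avoids1_23 p].

Definition increasing_on n (p : 'S_n) (I : {set 'I_n}) : bool :=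
  [forall i in I, forall j in I, (i < j) ==> (p i < p j)].

(* Index sets of the occurrences of the pattern 12...k in p. *)
Definition occ_incr (k n : nat) (p : 'S_n) : nat :=
  #|[set I : {set 'I_n} | (#|I| == k) && increasing_on p I]|.

Definition motzkin_count (k r n : nat) : nat :=
  #|[set p in motzkin n | occ_incr k p == r]|.

Local Open Scope ring_scope.

(* chebU_nonneg n = U_n, and chebU_neg n = U_(-n-1) is obtained by running the
   recurrence backwards from U_(-1) = 0 and U_(-2) = -1. *)
Fixpoint chebU_nonneg (R : comNzRingType) (n : nat) : {poly R} :=
  match n with
  | 0 => 1
  | 1 => 2 *: 'X
  | (m.+1 as m1).+1 => 2 *: 'X * chebU_nonneg R m1 - chebU_nonneg R m
  end.

Fixpoint chebU_neg (R : comNzRingType) (n : nat) : {poly R} :=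
  match n with
  | 0 => 0
  | 1 => - 1
  | (m.+1 as m1).+1 => 2 *: 'X * chebU_neg R m1 - chebU_neg R m
  end.

Definition chebU (R : comNzRingType) (r : int) : {poly R} :=
  match r with
  | Posz n => chebU_nonneg R n
  | Negz n => chebU_neg R n
  end.

Lemma chebU_0 (R : comNzRingType) : chebU R 0 = 1.
Proof. by []. Qed.

Lemma chebU_1 (R : comNzRingType) : chebU R 1 = 2 *: 'X.
Proof. by []. Qed.

Lemma chebU_rec (R : comNzRingType) (r : int) :
  chebU R r = 2 *: 'X * chebU R (r - 1) - chebU R (r - 2).
Proof.
case: r => [[|[|n]]|n].
- by rewrite /= mulr0 sub0r opprK.
- by rewrite /= mulr1 subr0.
- have -> : Posz n.+2 - 1 = Posz n.+1 by rewrite -addn1 PoszD addrK.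
  by have -> : Posz n.+2 - 2 = Posz n by rewrite -addn2 PoszD addrK.
- have -> : Negz n - 1 = Negz n.+1 by rewrite !NegzE -opprD -PoszD addn1.
  have -> : Negz n - 2 = Negz n.+2 by rewrite !NegzE -opprD -PoszD addn2.
  by rewrite /= subKr.
Qed.

Notation ratfun := {fraction {poly rat}}.

Local Notation "x %:F" := (tofrac x) : ring_scope.

Definition ratx : ratfun := 'X%:F.

(* The formal power series \sum_n c_n x^n is the expansion at x = 0 of f:
   f = p / q with q invertible as a power series, and q * (\sum_n c_n x^n) = p
   coefficient by coefficient. *)
Definition is_expansion (f : ratfun) (c : nat -> rat) : Prop :=
  exists p q : {poly rat},
    [/\ q`_0 != 0, f = p%:F / q%:F
      & forall n, \sum_(i < n.+1) q`_i * c (n - i)%N = p`_n].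

Lemma is_expansion_unique (f : ratfun) (c d : nat -> rat) :
  is_expansion f c -> is_expansion f d -> forall n, c n = d n.
Proof.
move=> [p [q [q0 -> cE]]] [p' [q' [q'0 fE dE]]].
have nz (s : {poly rat}) : s`_0 != 0 -> s%:F != 0 :> ratfun.
  by rewrite tofrac_eq0; apply: contraNneq => ->; rewrite coef0.
have pq : p * q' = p' * q.
  apply/eqP; rewrite -tofrac_eq !tofracM.
  by rewrite -eqr_div ?nz // fE.
have trunc (s t : {poly rat}) (u : nat -> rat) :
    (forall n, \sum_(i < n.+1) s`_i * u (n - i)%N = t`_n) ->
    forall N n, (n <= N)%N -> (s * \poly_(i < N.+1) u i)`_n = t`_n.
  move=> sE N n leN; rewrite coefM -sE; apply: eq_bigr => i _.
  by rewrite coef_poly ltnS (leq_trans (leq_subr _ _) leN).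
move=> n; set C := \poly_(i < n.+1) c i; set D := \poly_(i < n.+1) d i.
have eqCD m : (m <= n)%N -> (q * q' * C)`_m = (q * q' * D)`_m.
  move=> lemn.
  rewrite [q * q']mulrC -(mulrA q') -mulrA [q' * (q * D)]mulrCA.
  have -> : (q' * (q * C))`_m = (q' * p)`_m.
    rewrite !coefM; apply: eq_bigr => i _.
    by rewrite (trunc _ _ _ cE) // (leq_trans (leq_subr _ _) lemn).
  have -> : (q * (q' * D))`_m = (q * p')`_m.
    rewrite !coefM; apply: eq_bigr => i _.
    by rewrite (trunc _ _ _ dE) // (leq_trans (leq_subr _ _) lemn).
  by rewrite mulrC pq mulrC.
suff H m : (m <= n)%N -> C`_m = D`_m.
  by have := H n (leqnn n); rewrite !coef_poly ltnSn.
elim/ltn_ind: m => m IH lemn.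
have := eqCD m lemn; rewrite !coefM !big_ord_recl /= !subn0.
under eq_bigr => i _.
  rewrite IH; last 2 first.
  - by rewrite /bump add1n subnSK // leq_subr.
  - exact: leq_trans (leq_subr _ _) lemn.
  over.
move/addIr; apply: mulfI.
by rewrite coefM big_ord1 mulf_neq0.
Qed.

(* Main.v *)
Require Import Defs.
From mathcomp Require Import all_boot all_order all_fingroup all_algebra.
From mathcomp Require Import zify ring.
Import GRing.Theory.

(** A nonempty Motzkin permutation of length n is either n followed by a Motzkin
    permutation, or sigma m n tau with sigma > m > tau and sigma, tau Motzkin:
    132-avoidance puts everything left of n above everything right of it, and
    1-23-avoidance makes the entry just before n the smallest on its left.  For
    j >= 2 the latter has inc_j(sigma) + inc_(j-1)(sigma) + [j = 2] + inc_j(tau)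
    occurrences of 12...j.  Hence the series W_k(x, q) counting the permutations
    with no 12...(k+1) by length and by occurrences q of 12...k satisfies
    W_k = 1 + x W_k + x^2 W_(k-1) W_k for k >= 3, where W_1 must be replaced by
    q W_1 when k = 2.  This continued fraction unfolds to
    W_k = (P_(k-1) - q Q_(k-1)) / (P_k - q Q_k), where
    P_k = x^(k-1) U_(k-1) and Q_k = x^(k-1) (U_(k-2) - x U_(k-3)), and
    the coefficient of q^r is read off from Q_k P_(k-1) - Q_(k-1) P_k = x^(2k-2).
    Restricting to permutations with no 12...(k+1) costs nothing when r <= k,
    since an occurrence of 12...(k+1) contains k+1 occurrences of 12...k. *)

Set Implicit Arguments.
Unset Strict Implicit.
Unset Printing Implicit Defensive.

(** * Increasing subsequences of words *)

(** Number of increasing subsequences of length [k] with all entries [>= lo]; the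
    bound [lo] is what makes the recursion structural. *)
Fixpoint incr_count (lo k : nat) (s : seq nat) : nat :=
  if s is x :: s' then
    incr_count lo k s' +
    (if k is k'.+1 then if lo <= x then incr_count x.+1 k' s' else 0 else 0)
  else k == 0.

Lemma incr_count0 lo s : incr_count lo 0 s = 1.
Proof. by elim: s => //= x s ->. Qed.

Lemma incr_count_eq0S lo k s :
  incr_count lo k s = 0 -> incr_count lo k.+1 s = 0.
Proof.
elim: s lo k => [|x s IH] lo k //=.
case: k => [|k]; first by rewrite incr_count0.
move/eqP; rewrite addn_eq0 => /andP[/eqP /IH -> /eqP].
by case: ifP => // _ /IH.
Qed.

Lemma incr_count_cat_small lo k s1 s2 :
  {in s2, forall y, y < lo} -> incr_count lo k (s1 ++ s2) = incr_count lo k s1.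
Proof.
elim: s1 lo k => [|x s1 IH] lo k small /=.
  elim: s2 small => //= x s2 IH small.
  rewrite IH => [|y ys2]; last by apply: small; rewrite inE ys2 orbT.
  have := small x (mem_head _ _).
  by rewrite ltnNge; case: k {IH} => [|k] /negPf // ->; rewrite addn0.
rewrite IH //; case: k => // k; case: ifP => // lox.
by rewrite IH // => y /small /leq_trans; apply; apply: ltnW.
Qed.

(** Values drop from [s1] to [s2], so no increasing subsequence meets both. The length is positive
    because the empty subsequence would be counted twice. *)
Lemma incr_count_cat lo k s1 s2 :
  {in s1 & s2, forall x y, y < x} ->
  incr_count lo k.+1 (s1 ++ s2) = incr_count lo k.+1 s1 + incr_count lo k.+1 s2.
Proof.
elim: s1 => [|x s1 IH] //= lt21.
rewrite IH => [|y z ys zs]; last by apply: lt21; rewrite // inE ys orbT.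
rewrite addnAC incr_count_cat_small // => y ys.
by apply: ltnW; rewrite ltnS; apply: lt21; rewrite // mem_head.
Qed.

Lemma incr_count_rcons_max lo k s m :
  {in s, forall x, x < m} -> lo <= m ->
  incr_count lo k.+1 (rcons s m) = incr_count lo k.+1 s + incr_count lo k s.
Proof.
elim: s lo k => [|x s IH] lo k /= max lom.
  by rewrite lom add0n.
have max' : {in s, forall x, x < m}.
  by move=> y ys; apply: max; rewrite inE ys orbT.
have xm : x < m by apply: max; rewrite mem_head.
rewrite IH //; case: k => [|k]; first by rewrite !incr_count0; lia.
by case: ifP => _; rewrite ?IH //; lia.
Qed.

Lemma incr_count_shift a lo k s :
  incr_count (a + lo) k (map (addn a) s) = incr_count lo k s.
Proof.
elim: s lo k => //= x s IH lo k; rewrite IH; case: k => // k.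
by rewrite leq_add2l -addnS IH.
Qed.

Lemma incr_count_lo lo k s :
  {in s, forall x, lo <= x} -> incr_count lo k s = incr_count 0 k s.
Proof.
elim: s => //= x s IH lox; rewrite lox ?mem_head // IH // => y ys.
by apply: lox; rewrite inE ys orbT.
Qed.

(** * Words avoiding 132 and 1-23 *)

Fixpoint av132 (s : seq nat) : bool :=
  if s is x :: s' then pairwise (fun b c => ~~ ((x < c) && (c < b))) s' && av132 s'
  else true.

(** [sorted] replaces the [pairwise] of [av132] because the last two letters of 1-23 must be
    adjacent. *)
Fixpoint av1_23 (s : seq nat) : bool :=
  if s is x :: s' then sorted (fun b c => ~~ ((x < b) && (b < c))) s' && av1_23 s'
  else true.

(** The later entries of a 132 exceed its first one, so an occurrence starting in [s1] cannot reach
    [s2]. *)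
Lemma av132_cat s1 s2 :
  {in s1 & s2, forall x y, y < x} -> av132 (s1 ++ s2) = av132 s1 && av132 s2.
Proof.
elim: s1 => [|x s1 IH] //= lt21.
rewrite IH => [|y z ys zs]; last by apply: lt21; rewrite // inE ys orbT.
rewrite pairwise_cat andbA; congr (_ && _ && _).
have lt2 c : c \in s2 -> (x < c) = false.
  by move=> cs; apply/negbTE; rewrite -leqNgt ltnW // lt21 ?mem_head.
rewrite [X in X && _](_ : _ = true) /=; last first.
  by apply/allrelP => b c bs cs; rewrite lt2.
rewrite [X in _ && X](_ : _ = true) ?andbT //.
apply/(pairwiseP 0) => i j ilt jlt _.
by rewrite lt2 ?mem_nth.
Qed.

Lemma av132_rcons_max s m :
  {in s, forall x, x < m} -> av132 (rcons s m) = av132 s.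
Proof.
elim: s => //= x s IH max.
have max' : {in s, forall x, x < m}.
  by move=> y ys; apply: max; rewrite inE ys orbT.
rewrite IH // pairwise_rcons [all _ _](_ : _ = true) //.
by apply/allP => b /max' bm /=; rewrite andbC ltnNge (ltnW bm).
Qed.

Lemma av132_rcons_min s b :
  {in s, forall x, b < x} -> av132 (rcons s b) = av132 s.
Proof.
move=> min; rewrite -cats1 av132_cat ?andbT // => x y xs.
by rewrite inE => /eqP ->; apply: min.
Qed.

(** Otherwise x, m, y would form a 132. *)
Lemma av132_split s1 s2 m x y :
  av132 (s1 ++ m :: s2) -> x \in s1 -> y \in s2 -> y < m -> y <= x.
Proof.
elim: s1 => //= z s1 IH /andP[pw av]; rewrite inE => /orP[/eqP ->|xs] ys ym.
  move: pw; rewrite pairwise_cat pairwise_cons => /and4P[_ _ /allP gt2 _].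
  by move: (gt2 y ys); rewrite ym andbT -leqNgt.
exact: IH.
Qed.

Lemma sorted_cat_small x s1 s2 :
  {in s2, forall y, y < x} ->
  sorted (fun b c => ~~ ((x < b) && (b < c))) (s1 ++ s2) =
  sorted (fun b c => ~~ ((x < b) && (b < c))) s1.
Proof.
move=> small.
have path2 b : path (fun b c => ~~ ((x < b) && (b < c))) b s2.
  elim: s2 b small => //= c s2 IH b small.
  rewrite IH ?andbT => [|y ys]; last by apply: small; rewrite inE ys orbT.
  by have := small c (mem_head _ _); lia.
case: s1 => [|b s1] /=; last by rewrite cat_path path2 andbT.
by case: s2 path2 {small} => //= c s2 /(_ 0) /andP[].
Qed.

Lemma av1_23_cat s1 s2 :
  {in s1 & s2, forall x y, y < x} -> av1_23 (s1 ++ s2) = av1_23 s1 && av1_23 s2.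
Proof.
elim: s1 => [|x s1 IH] //= lt21.
rewrite IH => [|y z ys zs]; last by apply: lt21; rewrite // inE ys orbT.
rewrite sorted_cat_small ?andbA // => y ys.
by apply: lt21; rewrite ?mem_head.
Qed.

(** The new adjacent pair b, m completes a 1-23 with any earlier entry below b. This forces the
    entry just before the maximum to be minimal. *)
Lemma av1_23_rcons_rcons s b m :
  {in s, forall x, x < m} -> b < m ->
  av1_23 (rcons (rcons s b) m) = all (fun x => b <= x) s && av1_23 (rcons s b).
Proof.
elim: s => //= x s IH max bm.
rewrite IH // => [|y ys]; last by apply: max; rewrite inE ys orbT.
rewrite -cats1 [sorted _ (rcons s b ++ _)](_ : _ =
  (b <= x) && sorted (fun b c => ~~ ((x < b) && (b < c))) (rcons s b)).
  by case: (b <= x); case: (sorted _ _); case: (all _ _).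
case: s {IH max} => [|y s] /=; first by rewrite bm !andbT -leqNgt.
by rewrite cat_path /= last_rcons bm !andbT -leqNgt andbC.
Qed.

Lemma av1_23_rcons_min_max s b m :
  {in s, forall x, b < x} -> {in s, forall x, x < m} -> b < m ->
  av1_23 (rcons (rcons s b) m) = av1_23 s.
Proof.
move=> min max bm; rewrite av1_23_rcons_rcons //.
rewrite (_ : all _ _ = true) /=; last by apply/allP => x /min /ltnW.
rewrite -cats1 av1_23_cat ?andbT // => x y xs.
by rewrite inE => /eqP ->; apply: min.
Qed.

Lemma av132_shift a s : av132 (map (addn a) s) = av132 s.
Proof.
elim: s => //= x s ->; rewrite pairwise_map; congr (_ && _).
by apply: eq_pairwise => b c /=; rewrite !ltn_add2l.
Qed.

Lemma av1_23_shift a s : av1_23 (map (addn a) s) = av1_23 s.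
Proof.
elim: s => //= x s ->; rewrite sorted_map; congr (_ && _).
by apply: eq_sorted => b c /=; rewrite !ltn_add2l.
Qed.

(** * Decomposition of Motzkin words at their largest entry *)

Definition motzkin_words n : seq (seq nat) :=
  [seq w <- permutations (iota 0 n) | av132 w && av1_23 w].

Lemma mem_motzkin_words n w :
  (w \in motzkin_words n) = [&& perm_eq w (iota 0 n), av132 w & av1_23 w].
Proof. by rewrite mem_filter mem_permutations andbC. Qed.

Lemma motzkin_words_uniq n : uniq (motzkin_words n).
Proof. by rewrite filter_uniq // permutations_uniq. Qed.

Lemma motzkin_words_size n w : w \in motzkin_words n -> size w = n.
Proof. by rewrite mem_motzkin_words => /andP[/perm_size ->]; rewrite size_iota. Qed.

Lemma motzkin_words_lt n w x : w \in motzkin_words n -> x \in w -> x < n.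
Proof.
by rewrite mem_motzkin_words => /andP[/perm_mem -> _]; rewrite mem_iota.
Qed.

(** The word sigma m N tau with N = n+1 and m = n - i, where sigma has been
    standardized to the values [0 .. i-1]. *)
Definition glue n i (st : seq nat * seq nat) : seq nat :=
  rcons (rcons (map (addn (n - i).+1) st.1) (n - i)) n.+1 ++ st.2.

(** Sorting [s2] and [s1] separately and concatenating gives a sorted arrangement of the interval,
    hence the interval itself, which is cut after m entries. *)
Lemma perm_eq_iota_cat a m n s1 s2 :
  perm_eq (s1 ++ s2) (iota a (m + n)) -> size s2 = m ->
  {in s1 & s2, forall x y, y < x} ->
  perm_eq s2 (iota a m) /\ perm_eq s1 (iota (a + m) n).
Proof.
move=> pe sz lt21.
have : sort leq s2 ++ sort leq s1 = iota a m ++ iota (a + m) n.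
  rewrite -iotaD; apply: (sorted_eq leq_trans anti_leq).
  - rewrite sorted_pairwise; last exact: leq_trans.
    rewrite pairwise_cat -!sorted_pairwise; try exact: leq_trans.
    rewrite !sort_sorted ?andbT; try exact: leq_total.
    apply/allrelP => x y; rewrite !mem_sort => xs ys.
    exact/ltnW/lt21.
  - exact: iota_sorted.
  - apply: perm_trans pe; rewrite perm_catC; apply: perm_cat;
    by rewrite perm_sort.
move/eqP; rewrite eqseq_cat ?size_sort ?size_iota // => /andP[/eqP <- /eqP <-].
by rewrite ![perm_eq _ (sort _ _)]perm_sym !perm_sort.
Qed.

Lemma iota_shift a n : map (addn a) (iota 0 n) = iota a n.
Proof. by rewrite -iotaDl addn0. Qed.

Lemma perm_iota_recr n : perm_eq (n :: iota 0 n) (iota 0 n.+1).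
Proof. by rewrite -addn1 iotaD add0n /= cats1 perm_sym perm_rcons. Qed.

Lemma cons_motzkin_words n w :
  (n :: w \in motzkin_words n.+1) = (w \in motzkin_words n).
Proof.
rewrite !mem_motzkin_words -(permPr (perm_iota_recr n)) perm_cons.
case pe: perm_eq => //.
have lt x : x \in w -> x < n by rewrite (perm_mem pe) mem_iota.
have lt1 : {in [:: n] & w, forall x y, y < x}.
  by move=> x y; rewrite inE => /eqP ->; apply: lt.
by rewrite -cat1s av132_cat // av1_23_cat.
Qed.

Lemma glue_block_gt n i s t :
  i <= n -> s \in motzkin_words i -> t \in motzkin_words (n - i) ->
  {in rcons (rcons (map (addn (n - i).+1) s) (n - i)) n.+1 & t, forall x y, y < x}.
Proof.
move=> lein _ tP x y; rewrite !(mem_rcons, inE) => /or3P[/eqP->|/eqP->|/mapP[z _ ->]];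
  by move=> /(motzkin_words_lt tP); lia.
Qed.

Lemma glue_prefix_lt n i s x :
  i <= n -> s \in motzkin_words i ->
  x \in rcons (map (addn (n - i).+1) s) (n - i) -> x < n.+1.
Proof.
move=> lein sP; rewrite mem_rcons inE => /orP[/eqP->|/mapP[z zs ->]].
  by rewrite ltnS leq_subr.
by have := motzkin_words_lt sP zs; lia.
Qed.

Lemma glue_motzkin_words n i s t :
  i <= n -> s \in motzkin_words i -> t \in motzkin_words (n - i) ->
  glue n i (s, t) \in motzkin_words n.+2.
Proof.
move=> lein sP tP; have lt21 := glue_block_gt lein sP tP.
have max x := @glue_prefix_lt n i s x lein sP.
rewrite mem_motzkin_words /glue /= av132_cat // av1_23_cat //.
rewrite av132_rcons_max // av1_23_rcons_min_max; last 3 first.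
- by move=> x /mapP[z _ ->]; rewrite addSn ltnS leq_addr.
- by move=> x xs; apply: max; rewrite mem_rcons inE xs orbT.
- by rewrite ltnS leq_subr.
rewrite av132_rcons_min => [|x /mapP[z _ ->]]; last by rewrite addSn ltnS leq_addr.
rewrite av132_shift av1_23_shift.
move: sP tP; rewrite !mem_motzkin_words => /and3P[pes -> ->] /and3P[pet -> ->].
rewrite !andbT -(permPr (perm_iota_recr n.+1)).
rewrite cat_rcons perm_catC cat_cons perm_cons perm_catC cat_rcons perm_catC.
have -> : n.+1 = (n - i).+1 + i by rewrite addSn subnK.
rewrite iotaD perm_cat //; last by rewrite -iota_shift perm_map.
by rewrite -(permPr (perm_iota_recr _)) perm_cons.
Qed.

Lemma motzkin_words_decomp n w :
  w \in motzkin_words n.+2 ->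
  (exists2 t, t \in motzkin_words n.+1 & w = n.+1 :: t) \/
  exists i s t, [/\ i <= n, s \in motzkin_words i, t \in motzkin_words (n - i)
    & w = glue n i (s, t)].
Proof.
move=> wP; move: (wP); rewrite mem_motzkin_words => /and3P[pe a1 a2].
have /splitPr wE : n.+1 \in w by rewrite (perm_mem pe) mem_iota /=.
case: wE wP pe a1 a2 => s1 t wP pe a1 a2.
(* An empty left part means that the largest entry comes first; otherwise [b] is the entry just
   before it. *)
case/lastP: s1 => [|s b] in wP pe a1 a2 *.
  by left; exists t; rewrite // -cons_motzkin_words.
right.
have un : uniq (rcons s b ++ n.+1 :: t) by rewrite (perm_uniq pe) iota_uniq.
have pe' : perm_eq (rcons s b ++ t) (iota 0 n.+1).
  rewrite -(perm_cons n.+1) (permPr (perm_iota_recr _)) -(permPr pe).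
  by rewrite perm_sym perm_catC cat_cons perm_cons perm_catC.
have lt x : x \in rcons s b ++ t -> x < n.+1 by rewrite (perm_mem pe') mem_iota.
have un' : uniq (rcons s b ++ t) by rewrite (perm_uniq pe') iota_uniq.
have lt1 : {in rcons s b & t, forall x y, y < x}.
  move=> x y xs yt; rewrite ltn_neqAle; apply/andP; split.
    move: un'; rewrite cat_uniq => /and3P[_ /hasPn /(_ _ yt) nin _].
    by apply: contraNneq nin => ->.
  by apply: (av132_split a1 xs yt); apply: lt; rewrite mem_cat yt orbT.
have lt1' : {in rcons (rcons s b) n.+1 & t, forall x y, y < x}.
  move=> x y; rewrite mem_rcons inE => /orP[/eqP->|]; last exact: lt1.
  by move=> yt; apply: lt; rewrite mem_cat yt orbT.
move: a1 a2; rewrite -cat_rcons av132_cat // av1_23_cat //.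
have max : {in rcons s b, forall x, x < n.+1}.
  by move=> x xs; apply: lt; rewrite mem_cat xs.
rewrite av132_rcons_max // av1_23_rcons_rcons; last 2 first.
- by move=> x xs; apply: max; rewrite mem_rcons inE xs orbT.
- by apply: max; rewrite mem_rcons mem_head.
case/andP=> a1s a1t /andP[/andP[/allP min a2s] a2t].
have min' : {in s & [:: b], forall x y, y < x}.
  move=> x y xs; rewrite inE => /eqP ->; rewrite ltn_neqAle min // andbT.
  move: un'; rewrite cat_uniq rcons_uniq => /andP[/andP[nin _] _].
  by apply: contraNneq nin => ->.
have szE : size s + size t = n.
  by have := perm_size pe'; rewrite size_cat size_rcons size_iota => -[].
set i := size s.
have lein : i <= n by rewrite -szE leq_addr.
have szt : size t = n - i by rewrite -szE addKn.
have nE : n.+1 = (n - i) + i.+1 by rewrite addnS subnK.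
(* The interval of values is cut twice: [t] takes the lowest n - i, [b] the next one, and [s] the
   rest. *)
have [pet pesb] : perm_eq t (iota 0 (n - i)) /\ perm_eq (rcons s b) (iota (n - i) i.+1).
  by apply: perm_eq_iota_cat => //; rewrite -nE.
have [peb pes] : perm_eq [:: b] (iota (n - i) 1) /\ perm_eq s (iota (n - i + 1) i).
  by apply: perm_eq_iota_cat => //; rewrite cats1 add1n.
have bE : b = n - i.
  by have := perm_mem peb b; rewrite !inE eqxx => /esym/eqP.
have pes' : perm_eq (map (subn^~ (n - i).+1) s) (iota 0 i).
  have /(perm_map (subn^~ (n - i).+1)) := pes; rewrite addn1 -iota_shift -map_comp.
  by rewrite [X in perm_eq _ X]map_id_in // => x _ /=; rewrite addKn.
have sE : s = map (addn (n - i).+1) (map (subn^~ (n - i).+1) s).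
  rewrite -map_comp -[LHS]map_id; apply/eq_in_map => x xs /=.
  by rewrite subnKC // -bE; apply: min' => //; rewrite mem_head.
move: a1s a2s; rewrite -cats1 av132_cat // av1_23_cat // !andbT sE.
rewrite av132_shift av1_23_shift => a1s a2s.
exists i, (map (subn^~ (n - i).+1) s), t; split=> //.
- by rewrite mem_motzkin_words pes' a1s a2s.
- by rewrite mem_motzkin_words pet a1t a2t.
- by rewrite /glue /= cats1 bE.
Qed.

Lemma perm_motzkin_words n :
  perm_eq (motzkin_words n.+2)
    ([seq n.+1 :: w | w <- motzkin_words n.+1] ++
     [seq glue n i st | i <- iota 0 n.+1,
        st <- [seq (s, t) | s <- motzkin_words i, t <- motzkin_words (n - i)]]).
Proof.
have memE i st : st \in [seq (s, t) | s <- motzkin_words i, t <- motzkin_words (n - i)] ->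
    [/\ size st.1 = i, st.1 \in motzkin_words i & st.2 \in motzkin_words (n - i)].
  by case/allpairsP => -[s t] /= [sP tP ->]; rewrite (motzkin_words_size sP).
(* The position of n+1 recovers i, so the blocks for different i are disjoint, and also disjoint
   from the words that start with n+1. *)
have idx i st : i <= n -> st.1 \in motzkin_words i -> index n.+1 (glue n i st) = i.+1.
  move=> lein sP; rewrite /glue cat_rcons index_cat ifN; last first.
    by apply/negP => /(glue_prefix_lt lein sP); rewrite ltnn.
  by rewrite /= eqxx addn0 size_rcons size_map (motzkin_words_size sP).
apply: uniq_perm; first exact: motzkin_words_uniq.
  rewrite cat_uniq map_inj_uniq => [|? ? []] //; rewrite motzkin_words_uniq andTb.
  apply/andP; split.
    apply/hasPn => w /allpairsPdep[i [st [iP stP ->]]].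
    have [_ sP _] := memE _ _ stP; rewrite mem_iota /= in iP.
    by apply/negP => /mapP[v _ /(congr1 (index n.+1))]; rewrite idx //= eqxx.
  apply: allpairs_uniq_dep => [|i _|]; first exact: iota_uniq.
    by apply: allpairs_uniq; rewrite ?motzkin_words_uniq // => -[? ?] [? ?] _ _ [-> ->].
  move=> u v /allpairsPdep[i [[s t] [iP stP ->]]] /allpairsPdep[j [[s' t'] [jP stP' ->]]].
  have [szs sP tP] := memE _ _ stP; have [szs' sP' tP'] := memE _ _ stP'.
  move=> /= eqg.
  have eqij : i = j.
    move: iP jP; rewrite !mem_iota /= !ltnS => lein lejn.
    have := congr1 (index n.+1) eqg; rewrite idx // idx // => -[//].
  move/eqP: eqg; rewrite -eqij /glue eqseq_cat /=; last first.
    by rewrite !size_rcons !size_map; move: szs szs' => /= -> ->; rewrite eqij.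
  rewrite !eqseq_rcons !eqxx !andbT => /andP[/eqP /(inj_map (@addnI _)) -> /eqP ->].
  by [].
move=> w; rewrite mem_cat; apply/idP/orP => [/motzkin_words_decomp[]|].
- by case=> t tP ->; left; apply: map_f.
- case=> i [s [t [lein sP tP ->]]]; right.
  by apply/allpairsPdep; exists i, (s, t); rewrite mem_iota /= ltnS lein allpairs_f.
- case=> [/mapP[t tP ->]|/allpairsPdep[i [st [iP stP ->]]]].
    by rewrite cons_motzkin_words.
  have [_ sP tP] := memE _ _ stP.
  rewrite [st]surjective_pairing; apply: glue_motzkin_words => //.
  by move: iP; rewrite mem_iota.
Qed.

(** * Permutations and their words *)

Lemma av132P s :
  reflect (forall i j k, i < j -> j < k -> k < size s ->
             ~~ ((nth 0 s i < nth 0 s k) && (nth 0 s k < nth 0 s j)))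
          (av132 s).
Proof.
elim: s => [|x s IH] /=; first by constructor.
apply: (iffP andP) => [[pw /IH av] [|i] [|j] [|k] //|av].
- by rewrite !ltnS /= => _ jk ks; apply: (pairwiseP 0 pw) => //; apply: ltn_trans jk ks.
- by rewrite !ltnS; apply: av.
split; last by apply/IH => i j k ij jk ks; apply: (av i.+1 j.+1 k.+1).
by apply/(pairwiseP 0) => j k _ ks jk; apply: (av 0 j.+1 k.+1).
Qed.

Lemma av1_23P s :
  reflect (forall a b, a < b -> b.+1 < size s ->
             ~~ ((nth 0 s a < nth 0 s b) && (nth 0 s b < nth 0 s b.+1)))
          (av1_23 s).
Proof.
elim: s => [|x s IH] /=; first by constructor.
apply: (iffP andP) => [[srt /IH av] [|a] [|b] //|av].
- by rewrite !ltnS /= => _; apply: (sortedP 0 srt).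
- by rewrite !ltnS; apply: av.
split; last by apply/IH => a b ab bs; apply: (av a.+1 b.+1).
by apply/(sortedP 0) => b bs; apply: (av 0 b.+1).
Qed.

Definition perm_word n (p : 'S_n) : seq nat := [seq val (p i) | i <- enum 'I_n].

Lemma size_perm_word n (p : 'S_n) : size (perm_word p) = n.
Proof. by rewrite size_map size_enum_ord. Qed.

Lemma nth_perm_word n (p : 'S_n) (i : 'I_n) : nth 0 (perm_word p) i = p i.
Proof. by rewrite (nth_map i) ?size_enum_ord // nth_ord_enum. Qed.

Lemma avoids132E n (p : 'S_n) : avoids132 p = av132 (perm_word p).
Proof.
apply/idP/av132P => [av i j k ij jk|av].
  rewrite size_perm_word => kn; have jn := ltn_trans jk kn; have ilt := ltn_trans ij jn.
  apply: contra av => h; apply/existsP; exists (Ordinal ilt).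
  apply/existsP; exists (Ordinal jn); apply/existsP; exists (Ordinal kn).
  by rewrite /= ij jk -!nth_perm_word.
apply/existsPn => i; apply/existsPn => j; apply/existsPn => k.
apply/negP => /and4P[ij jk h1 h2].
by have := av i j k ij jk; rewrite size_perm_word !nth_perm_word h1 h2 => /(_ (ltn_ord k)).
Qed.

Lemma avoids1_23E n (p : 'S_n) : avoids1_23 p = av1_23 (perm_word p).
Proof.
apply/idP/av1_23P => [av a b ab|av].
  rewrite size_perm_word => cn; have bn := ltnW cn; have an := ltn_trans ab bn.
  apply: contra av => h; apply/existsP; exists (Ordinal an).
  apply/existsP; exists (Ordinal bn); apply/existsP; exists (Ordinal cn).
  by rewrite /= ab eqxx -!nth_perm_word.
apply/existsPn => a; apply/existsPn => b; apply/existsPn => c.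
apply/negP => /and4P[ab /eqP cE h1 h2].
by have := av a b ab; rewrite size_perm_word -cE !nth_perm_word h1 h2 => /(_ (ltn_ord c)).
Qed.

Lemma perm_word_inj n : injective (@perm_word n).
Proof.
move=> p q eqpq; apply/permP => i; apply: val_inj.
by rewrite /= -!nth_perm_word eqpq.
Qed.

Lemma perm_word_iota n (p : 'S_n) : perm_eq (perm_word p) (iota 0 n).
Proof.
rewrite -val_enum_ord /perm_word map_comp; apply: perm_map.
apply: uniq_perm; [by rewrite map_inj_uniq ?enum_uniq //; apply: perm_inj|
  exact: enum_uniq|].
move=> i; rewrite mem_enum; apply/mapP; exists (p^-1%g i); rewrite ?mem_enum //.
by rewrite permKV.
Qed.

Lemma perm_wordP n w : perm_eq w (iota 0 n) -> exists p : 'S_n, w = perm_word p.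
Proof.
move=> pe; have sz : size w = n by rewrite (perm_size pe) size_iota.
have lt (i : 'I_n) : nth 0 w i < n.
  have : nth 0 w i \in w by rewrite mem_nth ?sz.
  by rewrite (perm_mem pe) mem_iota.
have inj : injective (fun i => Ordinal (lt i)).
  move=> i j [] /eqP; rewrite nth_uniq ?sz // => [/eqP /val_inj //|].
  by rewrite (perm_uniq pe) iota_uniq.
exists (perm inj); apply: (@eq_from_nth _ 0) => [|i];
  rewrite sz ?size_perm_word // => ilt.
by rewrite (nth_perm_word _ (Ordinal ilt)) permE.
Qed.

Lemma perm_words_motzkin n :
  perm_eq [seq perm_word p | p <- enum (motzkin n)] (motzkin_words n).
Proof.
apply: uniq_perm; rewrite ?motzkin_words_uniq //.
  by rewrite map_inj_uniq ?enum_uniq //; apply: perm_word_inj.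
move=> w; rewrite mem_motzkin_words; apply/mapP/and3P => [[p]|[pe a1 a2]].
  by rewrite mem_enum inE avoids132E avoids1_23E => /andP[? ?] ->; rewrite perm_word_iota.
have [p wE] := perm_wordP pe; exists p => //.
by rewrite mem_enum inE avoids132E avoids1_23E -wE a1.
Qed.

(** * Occurrences as bit masks *)

Fixpoint masks n : seq bitseq :=
  if n is n'.+1 then map (cons true) (masks n') ++ map (cons false) (masks n')
  else [:: [::]].

Lemma mem_masks n m : (m \in masks n) = (size m == n).
Proof.
elim: n m => [|n IH] [|b m] //=; rewrite mem_cat.
  by apply/orP; case=> /mapP[].
rewrite eqSS -IH; case: b.
  rewrite mem_map => [|? ? []] //; case: (m \in _) => //=.
  by apply/mapP; case=> ? _.
rewrite orbC mem_map => [|? ? []] //; case: (m \in _) => //=.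
by apply/mapP; case=> ? _.
Qed.

Lemma masks_uniq n : uniq (masks n).
Proof.
elim: n => //= n IH; rewrite cat_uniq !map_inj_uniq ?IH /= => [|? ? []|? ? []] //.
by rewrite andbT; apply/hasPn => _ /mapP[m _ ->]; apply/mapP => -[].
Qed.

(** The first bit decides whether x is kept. If it is, the bound [x.+1] on the rest becomes the
    comparison of x with the later kept entries. *)
Lemma incr_count_masks lo k s :
  incr_count lo k s =
  count (fun m => [&& count id m == k, all (leq lo) (mask m s) & pairwise ltn (mask m s)])
        (masks (size s)).
Proof.
elim: s lo k => [|x s IH] lo k /=; first by rewrite andbT addn0 eq_sym.
rewrite count_cat !count_map addnC; congr (_ + _); first last.
  by rewrite IH; apply: eq_count => m /=; rewrite add0n.
case: k => [|k]; first by elim: (masks _).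
case: ifP => lox; last first.
  by elim: (masks _) => //= m l <-; rewrite lox andbF.
rewrite IH; apply: eq_count => m /=; rewrite add1n eqSS lox /=.
case: (count id m == k) => //=; case allx : (all (ltn x) _); last first.
  by rewrite andbF.
rewrite (_ : all (leq lo) _ = true) //.
by apply: sub_all allx => y /= xy; apply: leq_trans lox (ltnW xy).
Qed.

Lemma pairwise_in_ord n (r : rel 'I_n) (s : seq 'I_n) :
  pairwise (fun i j : 'I_n => i < j) s ->
  reflect {in s &, forall i j : 'I_n, i < j -> r i j} (pairwise r s).
Proof.
elim: s => [|a s IH] /=; first by move=> _; apply: (iffP idP).
case/andP=> /allP lta /IH {}IH; apply: (iffP andP) => [[/allP ra /IH rs]|rs].
  move=> i j; rewrite !inE => /orP[/eqP->|is_] /orP[/eqP->|js] //.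
  - by rewrite ltnn.
  - by move=> _; apply: ra.
  - by have := lta i is_; rewrite ltnNge => + /ltnW => /negPf ->.
  - exact: rs.
split; last by apply/IH => i j is_ js; apply: rs; rewrite inE ?is_ ?js orbT.
by apply/allP => i is_; apply: rs; rewrite ?inE ?eqxx ?is_ ?orbT //; apply: lta.
Qed.

Lemma increasing_onE n (p : 'S_n) (I : {set 'I_n}) :
  increasing_on p I = pairwise ltn (mask [seq i \in I | i <- enum 'I_n] (perm_word p)).
Proof.
rewrite /perm_word -map_mask -filter_mask pairwise_map.
have srt : pairwise (fun i j : 'I_n => i < j) [seq i <- enum 'I_n | i \in I].
  apply: (subseq_pairwise (filter_subseq _ _)).
  have := iota_ltn_sorted 0 n.
  by rewrite -val_enum_ord sorted_pairwise ?pairwise_map //; apply: ltn_trans.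
apply/forallP/(pairwise_in_ord _ srt) => [inc i j|inc i].
  rewrite !mem_filter => /andP[iI _] /andP[jI _] ij.
  by have /implyP/(_ iI)/forallP/(_ j)/implyP/(_ jI)/implyP/(_ ij) := inc i.
apply/implyP => iI; apply/forallP => j; apply/implyP => jI; apply/implyP => ij.
by apply: inc; rewrite // mem_filter ?iI ?jI mem_enum.
Qed.

Lemma occ_incrE k n (p : 'S_n) : occ_incr k p = incr_count 0 k (perm_word p).
Proof.
rewrite incr_count_masks size_perm_word /occ_incr cardE size_filter.
pose f (I : {set 'I_n}) := [seq i \in I | i <- enum 'I_n].
have f_inj : injective f.
  move=> I J /eq_in_map eqIJ; apply/setP => i; apply: eqIJ.
  by rewrite mem_enum.
have /seq.permP <- : perm_eq (map f (enum {set 'I_n})) (masks n).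
  apply: uniq_perm => [||m]; [by rewrite map_inj_uniq //; exact: enum_uniq|
    exact: masks_uniq|].
  rewrite mem_masks; apply/mapP/eqP => [[I _ ->]|sz].
    by rewrite size_map size_enum_ord.
  rewrite /f; exists [set i : 'I_n | nth false m i]; rewrite ?mem_enum //.
  apply: (@eq_from_nth _ false) => [|i]; first by rewrite sz size_map size_enum_ord.
  rewrite sz => ilt.
  rewrite (nth_map (Ordinal ilt)) ?size_enum_ord // inE.
  by rewrite (nth_ord_enum _ (Ordinal ilt)).
rewrite count_map enumT; apply: eq_count => I /=; rewrite inE increasing_onE.
rewrite (_ : all _ _ = true) /=; last by apply/allP.
rewrite /f count_map; congr ((_ == k) && _).
by rewrite cardE size_filter enumT.
Qed.

(** Deleting each index of an occurrence in turn gives distinct sets, since the deleted index tells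
    them apart. *)
Lemma occ_incr_remove k n (p : 'S_n) :
  0 < occ_incr k.+1 p -> k.+1 <= occ_incr k p.
Proof.
case/card_gt0P => I; rewrite inE => /andP[/eqP cI /forallP incI].
have inj : {in I &, injective (fun i => I :\ i)}.
  move=> i j iI jI /setP/(_ i); rewrite !inE eqxx iI andbT.
  by case: eqP.
rewrite -cI -(card_in_imset inj); apply: subset_leq_card.
apply/subsetP => _ /imsetP[i iI ->]; rewrite inE.
apply/andP; split; first by have := cardsD1 i I; rewrite iI cI add1n => -[->].
apply/forallP => a; apply/implyP => /setD1P[_ aI].
apply/forallP => b; apply/implyP => /setD1P[_ bI].
by have /implyP/(_ aI)/forallP/(_ b)/implyP/(_ bI) := incI a.
Qed.

Lemma occ_incr_small k r n (p : 'S_n) :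
  r <= k -> occ_incr k p = r -> occ_incr k.+1 p = 0.
Proof.
move=> rk occ; apply/eqP; rewrite -leqn0 leqNgt.
by apply/negP => /occ_incr_remove; rewrite occ ltnNge rk.
Qed.

Local Open Scope ring_scope.

(** * Generating functions *)

(** Discarding the words with a 12...(k+1) closes the recursion: for k >= 2 a surviving sigma m n
    tau has no 12...k in sigma, so sigma contributes to the exponent of q only through
    12...(k-1). *)
Definition weight k (w : seq nat) : {poly rat} :=
  if incr_count 0 k.+1 w == 0%N then 'X^(incr_count 0 k w) else 0.

Definition weight_sum k n : {poly rat} := \sum_(w <- motzkin_words n) weight k w.

Lemma coef_weight_sum k r n : (r <= k)%N ->
  (weight_sum k n)`_r = (motzkin_count k r n)%:R.
Proof.
move=> rk; rewrite /weight_sum -(perm_big _ (perm_words_motzkin n)) big_map big_enum.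
rewrite coef_sum /motzkin_count -sum1dep_card natr_sum big_mkcondr /=.
apply: eq_bigr => p _; rewrite /weight -!occ_incrE.
case: eqP => occ1; last first.
  by rewrite coef0; case: eqP => // /(occ_incr_small rk).
by rewrite coefXn eq_sym; case: eqP.
Qed.

Lemma incr_count_cons_max k n t : {in t, forall x, (x < n)%N} ->
  incr_count 0 k.+1 (n :: t) = ((k == 0) + incr_count 0 k.+1 t)%N.
Proof.
move=> lt; rewrite -cat1s incr_count_cat => [|x y]; last first.
  by rewrite inE => /eqP ->; apply: lt.
by rewrite /=; case: k.
Qed.

Lemma weight_cons k n t : t \in motzkin_words n ->
  weight k.+1 (n :: t) = (if k == 0%N then 'X else 1) * weight k.+1 t.
Proof.
move=> tP; have lt x : x \in t -> (x < n)%N := motzkin_words_lt tP.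
rewrite /weight !incr_count_cons_max // add0n; case: eqP => _; last by rewrite mulr0.
by case: eqP => _; rewrite ?mul1r // add1n exprS.
Qed.

Lemma incr_count_glue k n i s t :
  (i <= n)%N -> s \in motzkin_words i -> t \in motzkin_words (n - i) ->
  incr_count 0 k.+2 (glue n i (s, t)) =
  (incr_count 0 k.+2 s + incr_count 0 k.+1 s + (k == 0) + incr_count 0 k.+2 t)%N.
Proof.
move=> lein sP tP; rewrite /glue incr_count_cat; last exact: glue_block_gt.
rewrite incr_count_rcons_max // => [|x]; last exact: glue_prefix_lt.
have rconsE j : incr_count 0 j.+1 (rcons (map (addn (n - i).+1) s) (n - i))%N =
    (incr_count 0 j.+1 s + (j == 0))%N.
  rewrite -cats1 incr_count_cat => [|x y /mapP[z _ ->]]; last first.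
    by rewrite inE => /eqP ->; rewrite addSn ltnS leq_addr.
  congr (_ + _)%N.
  rewrite -[RHS](incr_count_shift (n - i).+1%N) addn0 incr_count_lo // => x /mapP[z _ ->].
  exact: leq_addr.
by rewrite !rconsE addn0 addnA.
Qed.

Lemma weight_glue k n i s t :
  (i <= n)%N -> s \in motzkin_words i -> t \in motzkin_words (n - i) ->
  weight k.+2 (glue n i (s, t)) =
  (if k == 0%N then 'X else 1) * weight k.+1 s * weight k.+2 t.
Proof.
move=> lein sP tP; rewrite /weight !incr_count_glue // addn0.
(* The vanishing of the count for k+3 in [s] follows from that for k+2, so it drops out of the
   condition. *)
have -> : (incr_count 0 k.+3 s + incr_count 0 k.+2 s + incr_count 0 k.+3 t == 0)%N =
    (incr_count 0 k.+2 s == 0%N) && (incr_count 0 k.+3 t == 0%N).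
  rewrite !addn_eq0; congr (_ && _); apply: andb_idl => /eqP e.
  by rewrite incr_count_eq0S.
case: eqP => [->|_] /=; last by rewrite mulr0 mul0r.
case: eqP => [_|_]; last by rewrite mulr0.
by rewrite add0n !exprD ['X^_ * _ in LHS]mulrC; case: eqP.
Qed.

Lemma weight1_glue n i s t :
  (i <= n)%N -> s \in motzkin_words i -> t \in motzkin_words (n - i) ->
  weight 1 (glue n i (s, t)) = 0.
Proof.
by move=> lein sP tP; rewrite /weight incr_count_glue // addn1 addSn.
Qed.

Lemma big_motzkin_words (F : seq nat -> {poly rat}) n :
  \sum_(w <- motzkin_words n.+2) F w =
  \sum_(w <- motzkin_words n.+1) F (n.+1 :: w) +
  \sum_(i < n.+1) \sum_(s <- motzkin_words i) \sum_(t <- motzkin_words (n - i))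
    F (glue n i (s, t)).
Proof.
rewrite (perm_big _ (perm_motzkin_words n)) big_cat big_map; congr (_ + _).
rewrite big_allpairs_dep -(big_mkord xpredT (fun i => \sum_(s <- motzkin_words i)
  \sum_(t <- motzkin_words (n - i)) F (glue n i (s, t)))) /index_iota subn0.
by apply: eq_bigr => i _; rewrite big_allpairs_dep.
Qed.

Lemma motzkin_words0 : motzkin_words 0 = [:: [::]].
Proof. by []. Qed.

Lemma motzkin_words1 : motzkin_words 1 = [:: [:: 0%N]].
Proof. by []. Qed.

Lemma weight_sum0 k : weight_sum k.+1 0 = 1.
Proof. by rewrite /weight_sum motzkin_words0 big_seq1 /weight. Qed.

Lemma weight_sum1 k : weight_sum k.+1 1 = if k == 0%N then 'X else 1.
Proof. by rewrite /weight_sum motzkin_words1 big_seq1 /weight; case: k. Qed.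

(** Only the decreasing word survives at level 1, since a glued word contains the ascent m n; each
    of its n entries is an occurrence of the pattern 1. *)
Lemma weight_sum_level1 n : weight_sum 1 n = 'X^n.
Proof.
elim/ltn_ind: n => -[|[|n]] IH; rewrite ?weight_sum0 ?weight_sum1 //.
rewrite /weight_sum big_motzkin_words [X in _ + X]big1 => [|i _]; last first.
  rewrite big_seq big1 // => s sP; rewrite big_seq big1 // => t tP.
  by rewrite weight1_glue // -ltnS.
rewrite addr0 big_seq (eq_bigr (fun w => 'X * weight 1 w)) => [|w]; last first.
  by move/weight_cons ->.
by rewrite -big_seq -mulr_sumr -/(weight_sum _ _) IH // -exprS.
Qed.

Lemma weight_sum_rec k n :
  weight_sum k.+2 n.+2 = weight_sum k.+2 n.+1 +
    (if k == 0%N then 'X else 1) *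
    \sum_(i < n.+1) weight_sum k.+1 i * weight_sum k.+2 (n - i).
Proof.
rewrite {1}/weight_sum big_motzkin_words; congr (_ + _).
  by rewrite big_seq [RHS]big_seq; apply: eq_bigr => w /weight_cons ->; rewrite mul1r.
rewrite mulr_sumr; apply: eq_bigr => i _.
rewrite /weight_sum mulrCA mulr_suml big_seq [RHS]big_seq.
apply: eq_bigr => s sP; rewrite mulrA mulr_sumr [weight _ s * _]mulrC.
rewrite big_seq [RHS]big_seq; apply: eq_bigr => t tP.
by rewrite weight_glue // -ltnS.
Qed.

(** * Power series modulo x^N and the continued fraction *)

Definition eqX (R : nzRingType) N (A B : {poly R}) := forall n, (n < N)%N -> A`_n = B`_n.

Lemma eqX_trans (R : nzRingType) N (A B C : {poly R}) :
  eqX N A B -> eqX N B C -> eqX N A C.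
Proof. by move=> AB BC n nN; rewrite AB ?BC. Qed.

Lemma eqXD (R : nzRingType) N (A B C D : {poly R}) :
  eqX N A B -> eqX N C D -> eqX N (A + C) (B + D).
Proof. by move=> AB CD n nN; rewrite !coefD AB ?CD. Qed.

Lemma eqXMl (R : nzRingType) N (A B C : {poly R}) :
  eqX N A B -> eqX N (C * A) (C * B).
Proof.
move=> AB n nN; rewrite !coefM; apply: eq_bigr => i _.
by rewrite AB // (leq_ltn_trans (leq_subr _ _)).
Qed.

(** The three-term recurrence of the continued fraction. Arbitrary starting values and rings let it
    be carried along morphisms, from polynomials in x to bivariate ones and to rational
    functions. *)
Fixpoint motzkin_rec (R : comNzRingType) (x a b : R) (n : nat) : R :=
  match n with
  | 0 => a
  | 1 => b
  | (m.+1 as m1).+1 => (1 - x) * motzkin_rec x a b m1 - x ^+ 2 * motzkin_rec x a b m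
  end.

Lemma motzkin_recSS (R : comNzRingType) (x a b : R) n :
  motzkin_rec x a b n.+2 =
    (1 - x) * motzkin_rec x a b n.+1 - x ^+ 2 * motzkin_rec x a b n.
Proof. by []. Qed.

(** Formal power series in x are handled as polynomials truncated at degree [N],
    compared by [eqX N]; the outer variable is x and the inner one is q. *)
Definition weight_series k N : {poly {poly rat}} := \poly_(n < N) weight_sum k n.

(** Indices are shifted: [mark k] multiplies W_(k+1), so that W_1 becomes q W_1. *)
Definition mark k : {poly {poly rat}} := (if k == 0%N then 'X else 1)%:P.

Lemma weight_series_rec k N :
  eqX N ((1 - 'X - 'X^2 * (mark k * weight_series k.+1 N)) * weight_series k.+2 N) 1.
Proof.
move=> n nN.
have -> : (1 - 'X - 'X^2 * (mark k * weight_series k.+1 N)) * weight_series k.+2 N =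
  weight_series k.+2 N - 'X * weight_series k.+2 N
  - 'X^2 * (mark k * (weight_series k.+1 N * weight_series k.+2 N)) by ring.
rewrite !coefB coefXM coefXnM coefCM coefM coef1.
(* The coefficients of 1 and x come from the words of length 0 and 1; [weight_sum_rec] applies from
   x^2 on. *)
case: n nN => [|[|n]] nN.
- by rewrite coef_poly nN weight_sum0 !subr0.
- by rewrite !coef_poly nN (ltnW nN) weight_sum0 weight_sum1 subr0 subrr.
rewrite !coef_poly nN (ltnW nN) weight_sum_rec subn2 /=.
rewrite [weight_sum _ _ + _]addrC addrK.
apply/eqP; rewrite subr_eq0; apply/eqP; congr (_ * _); apply: eq_bigr => i _.
have nN' : (n < N)%N by do 2! apply: ltnW.
rewrite !coef_poly !(leq_ltn_trans _ nN') ?leq_subr //.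
by rewrite -ltnS.
Qed.

(** This is P_k - q Q_k. The starting values q and 1 - x q have quotient q W_1, as W_1 = 1 / (1 - x
    q). *)
Definition denom k : {poly {poly rat}} :=
  motzkin_rec 'X 'X%:P (1 - 'X * 'X%:P) k.

Lemma weight_series_denom k N :
  eqX N (denom k.+1 * (mark k * weight_series k.+1 N)) (denom k).
Proof.
elim: k => [|k IH].
  move=> n nN; rewrite /denom /mark /=.
  have -> : (1 - 'X * 'X%:P) * ('X%:P * weight_series 1 N) =
    'X%:P * (weight_series 1 N - 'X * ('X%:P * weight_series 1 N)) by ring.
  rewrite coefCM coefC coefB coefXM coefCM !coef_poly nN weight_sum_level1.
  case: n nN => [|n] nN; first by rewrite subr0 mulr1.
  by rewrite (ltnW nN) weight_sum_level1 -exprS subrr mulr0.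
rewrite /mark mul1r.
have -> : denom k.+2 * weight_series k.+2 N =
  (1 - 'X) * denom k.+1 * weight_series k.+2 N
  + (- 'X^2 * weight_series k.+2 N) * denom k.
  by rewrite /denom /=; ring.
apply: eqX_trans (_ : eqX N (denom k.+1 *
  ((1 - 'X - 'X^2 * (mark k * weight_series k.+1 N)) * weight_series k.+2 N)) _).
  have -> : denom k.+1 *
      ((1 - 'X - 'X^2 * (mark k * weight_series k.+1 N)) * weight_series k.+2 N) =
    (1 - 'X) * denom k.+1 * weight_series k.+2 N
    + (- 'X^2 * weight_series k.+2 N) * (denom k.+1 * (mark k * weight_series k.+1 N)).
    by ring.
  apply: eqXD => //; apply: eqXMl => n nN; by rewrite IH.
by have := eqXMl (denom k.+1) (@weight_series_rec k N); rewrite mulr1.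
Qed.

(** The starting values of P and Q come from U_0 = 1 and the backward values U_(-1) = 0, U_(-2) =
    -1, U_(-3) = -(1 - x)/x. *)
Definition chebP k : {poly rat} := motzkin_rec 'X 0 1 k.
Definition chebQ k : {poly rat} := motzkin_rec 'X (-1) 'X k.

Lemma rmorph_motzkin_rec (R S : comNzRingType) (g : {rmorphism R -> S}) x a b n :
  g (motzkin_rec x a b n) = motzkin_rec (g x) (g a) (g b) n.
Proof.
elim/ltn_ind: n => -[|[|n]] IH //.
by rewrite !motzkin_recSS -!IH // rmorphB !rmorphM rmorphB rmorph1.
Qed.

Lemma denomE k : denom k = (chebP k)^:P - 'X%:P * (chebQ k)^:P.
Proof.
rewrite /chebP /chebQ !rmorph_motzkin_rec /= map_polyX rmorphN rmorph0 rmorph1 /denom.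
elim/ltn_ind: k => -[|[|k]] IH; [by rewrite /=; ring|by rewrite /=; ring|].
by rewrite !motzkin_recSS !IH //; ring.
Qed.

(** A Casorati determinant of two solutions of the recurrence: each step multiplies it by x^2, and
    it is 1 at k = 0. *)
Lemma chebPQ k : chebQ k.+1 * chebP k - chebQ k * chebP k.+1 = 'X^(2 * k).
Proof.
elim: k => [|k IH]; first by rewrite /chebP /chebQ /= muln0 expr0; ring.
rewrite mulnS exprD -IH /chebP /chebQ !motzkin_recSS; ring.
Qed.

(** Makes the denominators invertible as power series. Modulo x the recurrence reads P_(k+2) =
    P_(k+1). *)
Lemma chebP_coef0 k : (chebP k.+1)`_0 = 1.
Proof.
elim/ltn_ind: k => -[|k] IH; first by rewrite /chebP /= coef1.
rewrite /chebP motzkin_recSS -!/(chebP _) coefB coefXnM.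
by rewrite mulrBl mul1r coefB coefXM /= !subr0 IH.
Qed.

Definition coef_series k r N : {poly rat} := \poly_(n < N) (weight_sum k n)`_r.

Lemma coef_map_weight_series (p : {poly rat}) k r N n : (n < N)%N ->
  (p^:P * weight_series k N)`_n`_r = (p * coef_series k r N)`_n.
Proof.
move=> nN; rewrite !coefM coef_sum; apply: eq_bigr => i _.
by rewrite coef_map coefCM !coef_poly (leq_ltn_trans (leq_subr _ _) nN).
Qed.

(** Coefficients of q^r are compared in (P_(k+2) - q Q_(k+2)) W_(k+2) = P_(k+1) - q Q_(k+1). *)
Lemma coef_series_denom k N n r : (n < N)%N ->
  (chebP k.+2 * coef_series k.+2 r N)`_n
    - (if r == 0%N then 0 else (chebQ k.+2 * coef_series k.+2 r.-1 N)`_n) =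
  (if r == 0%N then (chebP k.+1)`_n else 0) - (if r == 1%N then (chebQ k.+1)`_n else 0).
Proof.
move=> nN.
have := congr1 (fun p : {poly rat} => p`_r) (@weight_series_denom k.+1 N n nN).
rewrite /mark mul1r !denomE mulrBl -mulrA !coefB coef_map_weight_series //.
rewrite !coefCM !coefXM coef_map_weight_series // !coef_map !coefC => ->.
by case: r => [|[|r]].
Qed.

(** Write G_r for the coefficient of q^r, P, Q for index k+2 and P', Q' for index k+1. From P G_0 =
    P' and P G_1 = Q G_0 - Q' follows P^2 G_1 = Q P' - Q' P, a power of x; then P G_(r+2) = Q
    G_(r+1) is a geometric progression. *)
Lemma coef_series_closed k r N :
  eqX N (chebP k.+2 ^+ r.+2 * coef_series k.+2 r.+1 N) ('X^(2 * k.+1) * chebQ k.+2 ^+ r).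
Proof.
elim: r => [|r IH].
  have G0 : eqX N (chebP k.+2 * coef_series k.+2 0 N) (chebP k.+1).
    by move=> n nN; have := @coef_series_denom k N n 0 nN; rewrite /= !subr0.
  have G1 : eqX N (chebP k.+2 * coef_series k.+2 1 N)
      (chebQ k.+2 * coef_series k.+2 0 N - chebQ k.+1).
    move=> n nN; have := @coef_series_denom k N n 1 nN; rewrite /= sub0r coefB => /eqP.
    by rewrite subr_eq addrC => /eqP.
  rewrite expr0 mulr1 -chebPQ exprSr expr1 -mulrA.
  apply: eqX_trans (eqXMl _ G1) _.
  rewrite mulrBr mulrCA [chebQ k.+1 * _]mulrC.
  by apply: eqXD => //; apply: eqXMl.
have Gr : eqX N (chebP k.+2 * coef_series k.+2 r.+2 N)
    (chebQ k.+2 * coef_series k.+2 r.+1 N).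
  move=> n nN; have := @coef_series_denom k N n r.+2 nN; rewrite /= subr0 => /eqP.
  by rewrite subr_eq0 => /eqP.
rewrite exprSr -mulrA; apply: eqX_trans (eqXMl _ Gr) _.
by rewrite mulrCA [chebQ _ ^+ _]exprS [X in eqX _ _ X]mulrCA; apply: eqXMl.
Qed.

(** * Chebyshev polynomials *)

Lemma ratx_neq0 : ratx != 0.
Proof. by rewrite /ratx tofrac_eq0 polyX_eq0. Qed.

Lemma ratfun2_neq0 : 2 != 0 :> ratfun.
Proof. by rewrite -(rmorph_nat (@tofrac _)) tofrac_eq0 -polyC_natr polyC_eq0. Qed.

(** Since 2t = (1 - x)/x, rescaling by powers of x turns the Chebyshev recurrence into that of
    [motzkin_rec]. The scaling exponent is one less than the index, whence the factor x in the
    condition at 0. *)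
Lemma motzkin_rec_cheb (F : fieldType) (x a b : F) (f : nat -> F) :
  x != 0 -> 2 != 0 :> F ->
  (forall n, f n.+2 = 2 * ((1 - x) / (2 * x)) * f n.+1 - f n) ->
  f 0%N = x * a -> f 1%N = b ->
  forall n, f n.+1 = motzkin_rec x a b n.+1 / x ^+ n.
Proof.
move=> x0 two0 fE f0 f1 n.
suff fn : x ^+ n.+1 * f n.+1 = x * motzkin_rec x a b n.+1.
  by apply: (mulfI (expf_neq0 n.+1 x0));
    rewrite fn exprS -mulrA [x ^+ n * _]mulrCA divff ?expf_neq0 // mulr1.
elim/ltn_ind: n => -[|n] IH; first by rewrite f1 expr1.
have fn : x ^+ n * f n = x * motzkin_rec x a b n.
  by case: n IH => [|n] IH; [rewrite f0 mul1r|apply: IH].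
have -> : x * motzkin_rec x a b n.+2 =
  (1 - x) * (x * motzkin_rec x a b n.+1) - x ^+ 2 * (x * motzkin_rec x a b n).
  by rewrite motzkin_recSS; ring.
by rewrite -fn -IH // fE !exprS; field; rewrite x0.
Qed.

Lemma motzkin_rec_cheb_start (F : fieldType) (x : F) : x != 0 -> 2 != 0 :> F ->
  -1 - x * - (2 * ((1 - x) / (2 * x))) = x * -1.
Proof. by move=> x0 two0; field; rewrite x0. Qed.

(** The common scaling y cancels up to its square, which for y = x^(k+1) is the power of x in
    [coef_series_closed]. *)
Lemma div_exprSS (F : fieldType) (y p q : F) r : y != 0 -> p != 0 ->
  (q / y) ^+ r / (p / y) ^+ r.+2 = y ^+ 2 * q ^+ r / p ^+ r.+2.
Proof.
move=> y0 p0; rewrite !expr_div_n !exprS.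
by field; rewrite y0 p0 !expf_neq0.
Qed.

Lemma horner_chebU_rec (R : comNzRingType) (t : R) j :
  (chebU R j).[t] = 2 * t * (chebU R (j - 1)).[t] - (chebU R (j - 2)).[t].
Proof. by rewrite chebU_rec !hornerE. Qed.

(** The coefficient of x^n is already determined by the truncation at N = n+1. *)
Lemma is_expansion_truncated (p q : {poly rat}) (f : ratfun) (c : nat -> rat) :
  q`_0 != 0 -> f = tofrac p / tofrac q ->
  (forall N, eqX N (q * \poly_(n < N) c n) p) -> is_expansion f c.
Proof.
move=> q0 fE eqp; exists p, q; split=> // n.
rewrite -(eqp n.+1 n (ltnSn n)) coefM; apply: eq_bigr => i _.
by rewrite coef_poly ltnS leq_subr.
Qed.

Theorem theorem3p3 (k r : nat) (hk : (2 <= k)%N) (hr : (1 <= r <= k)%N) :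
  let U (j : int) : ratfun := (chebU ratfun j).[(1 - ratx) / (2 * ratx)] in
  is_expansion
    ((U (k%:Z - 2) - ratx * U (k%:Z - 3)) ^+ (r - 1) / U (k%:Z - 1) ^+ (r + 1))
    (fun n => (motzkin_count k r n)%:R).
Proof.
case: k r hk hr => [|[|k]] [|r] // _ /andP[_ rk] U.
rewrite subn1 addn1 /=.
have x0 := ratx_neq0; have two0 := ratfun2_neq0.
have Urec j : U j = 2 * ((1 - ratx) / (2 * ratx)) * U (j - 1) - U (j - 2).
  exact: horner_chebU_rec.
have Um1 : U (-1) = 0 by rewrite /U /= horner0.
have Um2 : U (-2) = -1 by rewrite /U /= hornerN hornerC.
(* Needed because the sequence for Q starts at index 0 with U_(-2) - x U_(-3). *)
have Um3 : U (-3) = - (2 * ((1 - ratx) / (2 * ratx))).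
  have := Urec (-1); rewrite -[-1 - 1]/(-2 : int) -[-1 - 2]/(-3 : int) Um1 Um2 mulrN1.
  by move/esym/eqP; rewrite subr_eq0 => /eqP.
have U0 : U 0 = 1 by rewrite /U /= hornerC.
(* Only the recurrence and the values above are used from here on. *)
clearbody U.
have UP : U (k.+2%:Z - 1) = tofrac (chebP k.+2) / ratx ^+ k.+1.
  rewrite rmorph_motzkin_rec rmorph0 rmorph1.
  apply: (@motzkin_rec_cheb _ _ _ _ (fun n => U (n%:Z - 1)) x0 two0 _ _ _ k.+1) => [n||].
  - by rewrite Urec; congr (_ * U _ - U _); lia.
  - by rewrite sub0r Um1 mulr0.
  - by rewrite subrr U0.
have UQ : U (k.+2%:Z - 2) - ratx * U (k.+2%:Z - 3) = tofrac (chebQ k.+2) / ratx ^+ k.+1.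
  rewrite rmorph_motzkin_rec rmorphN rmorph1.
  apply: (@motzkin_rec_cheb _ _ _ _ (fun n => U (n%:Z - 2) - ratx * U (n%:Z - 3))
    x0 two0 _ _ _ k.+1) => [n||].
  - rewrite [in LHS](Urec (n.+2%:Z - 3)) [in LHS](Urec (n.+2%:Z - 2)).
    have -> : n.+2%:Z - 2 - 1 = n.+1%:Z - 2 by lia.
    have -> : n.+2%:Z - 2 - 2 = n%:Z - 2 by lia.
    have -> : n.+2%:Z - 3 - 1 = n.+1%:Z - 3 by lia.
    have -> : n.+2%:Z - 3 - 2 = n%:Z - 3 by lia.
    (* With 2t generalized to [c], the goal is a polynomial identity without division. *)
    by cbv beta; move: (2 * _) => c; ring.
  - rewrite -[0%:Z - 2]/(-2 : int) -[0%:Z - 3]/(-3 : int) Um2 Um3.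
    exact: (motzkin_rec_cheb_start x0 two0).
  - rewrite -[1%:Z - 2]/(-1 : int) -[1%:Z - 3]/(-2 : int) Um1 Um2.
    by rewrite mulrN1 sub0r opprK.
apply: (@is_expansion_truncated ('X^(2 * k.+1) * chebQ k.+2 ^+ r) (chebP k.+2 ^+ r.+2)).
- by rewrite -horner_coef0 horner_exp horner_coef0 chebP_coef0 expr1n oner_neq0.
- have Pn0 : tofrac (chebP k.+2) != 0.
    by rewrite tofrac_eq0; apply/eqP => e; have := chebP_coef0 k.+1; rewrite e coef0.
  have xn0 := expf_neq0 k.+1 x0.
  rewrite UP UQ rmorphM !rmorphXn /= -/ratx mulnC exprM.
  exact: (div_exprSS _ _ xn0 Pn0).
move=> N.
have -> : \poly_(n < N) (motzkin_count k.+2 r.+1 n)%:R = coef_series k.+2 r.+1 N.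
  by apply/polyP => m; rewrite !coef_poly coef_weight_sum.
exact: coef_series_closed.
Qed.
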